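(* Let $(c_\nu)_{\nu\in\mathbb{Z}_{\ge 0}^7}$ be a family of octonions and let $$\rho=\limsup_{n\to\infty}\Bigl(\max_{\|\nu\|=n}\Bigl\|\frac{c_\nu}{n!}\Bigr\|\Bigr)^{1/n},\qquad \tau=\limsup_{n\to\infty}\Bigl(\sum_{\substack{\nu=(n_1,\dots,n_7)\\ n_1+\cdots+n_7=n,\ c_\nu\ne0}}\binom{n}{\nu}\Bigr)^{1/n}.$$ Then the series $$h(x)=\sum_{n=0}^\infty\ \sum_{\substack{\nu=(n_1,\dots,n_7)\\ n_1+\cdots+n_7=n}} V_\nu(x)\, c_\nu$$ converges compactly on $\{x\in O : \|x\|_O'<\tfrac{1}{\tau\rho}\}$.
   Context: $O$ denotes the octonions: the real vector space with basis $e_0,e_1,\dots,e_7$ and bilinear product $e_0e_j=e_j$, $e_ie_0=e_i$, and $e_ie_j=-\delta_{ij}e_0+\sum_{k=1}^{7}\varepsilon_{ijk}e_k$ for $i,j\in\{1,\dots,7\}$, where $\delta_{ij}$ is the Kronecker delta and $\varepsilon_{ijk}$ is the completely antisymmetric tensor equal to $+1$ for $ijk=123,145,176,246,257,347,365$ (and $0$ for triples that are not permutations of these). $\|\cdot\|$ is the Euclidean norm on $O\cong\mathbb{R}^8$. For $x=\sum_{i=0}^7 x_ie_i$ and $i\in\{1,\dots,7\}$ put $\zeta_i(x)=x_i-e_ix_0$ (real numbers are identified with multiples of $e_0$). For $\nu=(n_1,\dots,n_7)\in\mathbb{Z}_{\ge0}^7$ put $\|\nu\|=n_1+\cdots+n_7=n$,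 $\binom{n}{\nu}=\frac{n!}{n_1!\cdots n_7!}$ and $$V_\nu(x)=\frac1{n!}\sum_{(i_1,\dots,i_n)}\bigl(\cdots((\zeta_{i_1}(x)\zeta_{i_2}(x))\zeta_{i_3}(x))\cdots\bigr)\zeta_{i_n}(x),$$ the sum being over all words $(i_1,\dots,i_n)$ having exactly $n_s$ letters equal to $s$ for each $s=1,\dots,7$, with products bracketed from the left (the product over the empty word is $1$). An empty sum is $0$. The auxiliary norm on $O$ is $\|v_0+\sum_{i=1}^7e_iv_i\|_O'=\max_{i\in\{1,\dots,7\}}\|v_i-e_iv_0\|=\max_{i\in\{1,\dots,7\}}\sqrt{v_i^2+v_0^2}$. Conventions: $1/(\tau\rho)=\infty$ if $\tau\rho=0$ (the set is then all of $O$) and $1/(\tau\rho)=0$ if $\rho=\infty$ (the set is then empty; in this case $\tau\geq 1$). A series $\sum_n\sum_{\|\nu\|=n}V_\nu c_\nu$ converges compactly on an open set if its partial sums over $n\le N$ converge, as $N\to\infty$, uniformly on every compact subset of that set. *)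

(* Defs.v *)
From HB Require Import structures.
From mathcomp Require Import all_boot all_order all_algebra.
From mathcomp Require Import all_classical all_reals all_analysis.

Set Implicit Arguments.
Unset Strict Implicit.
Unset Printing Implicit Defensive.

Import Order.TTheory GRing.Theory Num.Theory.
Import numFieldNormedType.Exports.

Local Open Scope classical_set_scope.
Local Open Scope ring_scope.

(* Coordinate [x 0 ord0] is the real part of [x]; the indices 1, ..., 7 of the
   imaginary units are shifted to ['I_7] and re-embedded by [lift ord0]. *)
Notation octonion R := 'rV[R]_8.

Definition oe {R : realType} (i : 'I_8) : octonion R := delta_mx 0 i.

Definition im7 (i : 'I_7) : 'I_8 := lift ord0 i.

Definition oct_triples : seq (nat * nat * nat) :=
  [:: (1, 2, 3); (1, 4, 5); (1, 7, 6); (2, 4, 6); (2, 5, 7); (3, 4, 7);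
      (3, 6, 5)]%N.

Definition oct_cyclic (i j k : nat) : bool :=
  [|| (i, j, k) \in oct_triples, (j, k, i) \in oct_triples
    | (k, i, j) \in oct_triples].

(* The odd permutations of a triple are the cyclic rotations of the triple with
   two entries exchanged. *)
Definition oct_eps {R : realType} (i j k : nat) : R :=
  (oct_cyclic i j k)%:R - (oct_cyclic j i k)%:R.

Definition oe_mul {R : realType} (i j : 'I_8) : octonion R :=
  if i == ord0 then oe j
  else if j == ord0 then oe i
  else - (i == j)%:R *: oe ord0
       + \sum_(k : 'I_7) oct_eps i j (im7 k) *: oe (im7 k).

Definition omul {R : realType} (x y : octonion R) : octonion R :=
  \sum_(i < 8) \sum_(j < 8) (x 0 i * y 0 j) *: oe_mul i j.

Definition onorm {R : realType} (x : octonion R) : R :=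
  Num.sqrt (\sum_(i < 8) x 0 i ^+ 2).

Definition zeta {R : realType} (i : 'I_7) (x : octonion R) : octonion R :=
  x 0 (im7 i) *: oe ord0 - x 0 ord0 *: oe (im7 i).

Definition onorm' {R : realType} (x : octonion R) : R :=
  \big[Num.max/0]_(i < 7) onorm (zeta i x).

Notation multiindex := {ffun 'I_7 -> nat}.

Definition mnorm (nu : multiindex) : nat := \sum_(i < 7) nu i.

Definition midx (n : nat) : seq multiindex :=
  [seq nu <- [seq [ffun i => mu i : nat] | mu : {ffun 'I_7 -> 'I_n.+1}]
  | mnorm nu == n].

Lemma midx_uniq n : uniq (midx n).
Proof.
apply: filter_uniq; rewrite map_inj_uniq ?enum_uniq// => f g /ffunP fg.
by apply/ffunP => i; apply: val_inj; have := fg i; rewrite !ffunE.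
Qed.

Lemma mem_midx n nu : (nu \in midx n) = (mnorm nu == n).
Proof.
rewrite mem_filter andb_idr// => /eqP nun.
have nuS i : (nu i < n.+1)%N by rewrite ltnS -nun /mnorm (bigD1 i)//= leq_addr.
apply/mapP; exists [ffun i => Ordinal (nuS i)]; first by rewrite mem_enum.
by apply/ffunP => i; rewrite !ffunE.
Qed.

Definition multinomial {R : realType} (nu : multiindex) : R :=
  (mnorm nu)`!%:R / \prod_(i < 7) (nu i)`!%:R.

Definition oV {R : realType} (nu : multiindex) (x : octonion R) : octonion R :=
  (mnorm nu)`!%:R^-1 *:
  \sum_(w : (mnorm nu).-tuple 'I_7 | [forall s, count_mem s w == nu s])
    foldl (fun y i => omul y (zeta i x)) (oe ord0) w.

(* The exponent [n%:R^-1] is 0 for [n = 0], which does not affect the limsup. *)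
Definition rho {R : realType} (c : multiindex -> octonion R) : \bar R :=
  limn_esup (fun n =>
    ((\big[Num.max/0]_(nu <- midx n) onorm (n`!%:R^-1 *: c nu))
       `^ n%:R^-1)%:E).

Definition tau {R : realType} (c : multiindex -> octonion R) : \bar R :=
  limn_esup (fun n =>
    ((\sum_(nu <- midx n | c nu != 0) multinomial nu) `^ n%:R^-1)%:E).

Definition psum {R : realType} (c : multiindex -> octonion R) (N : nat)
    (x : octonion R) : octonion R :=
  \sum_(n < N.+1) \sum_(nu <- midx n) omul (oV nu x) (c nu).

Definition compactly_convergent {T : topologicalType} {V : uniformType}
    (U : set T) (f_ : nat -> T -> V) : Prop :=
  exists h : T -> V, forall K : set T,
    compact K -> K `<=` U -> {uniform K, f_ @ \oo --> h}.

(* Row vectors carry the sup norm in the library; by this equivalence, its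
   topology and uniformity are those of [onorm]. *)
Lemma onorm_equiv {R : realType} (x : octonion R) :
  `|x| <= onorm x /\ onorm x <= 8 * `|x|.
Proof.
have S0 : 0 <= \sum_(i < 8) x 0 i ^+ 2 by apply: sumr_ge0 => i _; exact: sqr_ge0.
split.
  rewrite [leLHS]/Num.Def.normr/= mx_normrE; apply: bigmax_le.
    exact: sqrtr_ge0.
  move=> [a i] _ /=; rewrite (ord1 a) -sqrtr_sqr; apply: ler_wsqrtr.
  by rewrite (bigD1 i)//= lerDl; apply: sumr_ge0 => j _; exact: sqr_ge0.
have le i : `|x 0 i| <= `|x|.
  rewrite [leRHS]/Num.Def.normr/= mx_normrE.
  exact: (le_bigmax _ (fun ij : 'I_1 * 'I_8 => `|x ij.1 ij.2|) (0, i)).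
rewrite -[leRHS]ger0_norm ?mulr_ge0// -sqrtr_sqr; apply: ler_wsqrtr.
apply: (@le_trans _ _ (\sum_(i < 8) `|x| ^+ 2)).
  by apply: ler_sum => i _; rewrite -real_normK ?num_real// ler_sqr ?nnegrE.
rewrite sumr_const card_ord exprMn -[leLHS]mulr_natl.
apply: ler_wpM2r; first exact: sqr_ge0.
by rewrite -natrX ler_nat.
Qed.

(* Main.v *)
Require Import Defs.
From HB Require Import structures.
From mathcomp Require Import all_boot all_order all_algebra.
From mathcomp Require Import all_classical all_reals all_analysis.
From mathcomp Require Import lra.

Import Order.TTheory GRing.Theory Num.Theory.
Import numFieldNormedType.Exports.

Local Open Scope classical_set_scope.
Local Open Scope ring_scope.

(** The octonion norm is multiplicative, so each word of length [n] in the
    [zeta i x] has norm at most [onorm' x ^+ n]; exactly [multinomial nu] words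
    have letter counts [nu]. Hence the degree [n] part of the series is at most
    [8 * (T n * M n * onorm' x ^+ n)], where [T n] is the sum of the multinomials
    over the support of [c] and [M n] the largest [onorm (n`!^-1 *: c nu)].
    By continuity [onorm'] attains its maximum on a compact subset of the domain,
    and since the limsups of the [n]-th roots of [T n] and [M n] are [tau] and
    [rho], the parts are dominated there by a geometric series. *)

Definition oct_struct (i j k : nat) : int :=
  if i == 0%N then (j == k)%:R
  else if j == 0%N then (i == k)%:R
  else if k == 0%N then - (i == j)%:R
  else (oct_cyclic i j k)%:R - (oct_cyclic j i k)%:R.

Lemma oe_mulE {R : realType} (i j k : 'I_8) :
  (oe_mul i j : octonion R) 0 k = (oct_struct i j k)%:~R.
Proof.
rewrite /oe_mul /oct_struct -!(inj_eq val_inj) /=.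
case: ifP => [_|i0].
  by rewrite mxE eqxx /= eq_sym -(inj_eq val_inj) rmorph_nat.
case: ifP => [_|j0].
  by rewrite mxE eqxx /= eq_sym -(inj_eq val_inj) rmorph_nat.
rewrite !mxE eqxx summxE /=.
case: (unliftP ord0 k) => [l|] -> /=.
  rewrite mulr0 add0r (bigD1 l) //= big1 ?addr0 => [|m ml].
    by rewrite !mxE !eqxx mulr1 rmorphB /= !rmorph_nat.
  by rewrite !mxE (inj_eq lift_inj) eq_sym (negbTE ml) andbF mulr0.
rewrite mulr1 big1 ?addr0 ?rmorphN /= ?rmorph_nat // => l _.
by rewrite !mxE mulr0.
Qed.

Lemma omulE {R : realType} (x y : octonion R) (k : 'I_8) :
  omul x y 0 k =
  \sum_(i < 8) \sum_(j < 8) x 0 i * y 0 j * (oct_struct i j k)%:~R.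
Proof.
rewrite summxE; apply: eq_bigr => i _; rewrite summxE; apply: eq_bigr => j _.
by rewrite mxE oe_mulE.
Qed.

(* Inner product of [e_i e_j] and [e_i' e_j'], as a [foldr] so that it computes. *)
Definition oct_gram (i j i' j' : nat) : int :=
  foldr (fun k s => oct_struct i j k * oct_struct i' j' k + s) 0 (iota 0 8).

Lemma oct_gramE (i j i' j' : nat) :
  oct_gram i j i' j' = \sum_(k < 8) oct_struct i j k * oct_struct i' j' k.
Proof.
rewrite -(big_mkord xpredT (fun k => oct_struct i j k * oct_struct i' j' k)).
by rewrite unlock /reducebig /oct_gram.
Qed.

(* The polarized composition law on basis vectors. *)
Lemma oct_gram_sym (i j i' j' : 'I_8) :
  oct_gram i j i' j' + oct_gram i' j i j' = (2 * ((i == i') && (j == j')))%:R.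
Proof.
pose s := iota 0 8.
have : all (fun i => all (fun j => all (fun i' => all (fun j' =>
  oct_gram i j i' j' + oct_gram i' j i j' ==
    (2 * ((i == i') && (j == j')))%:R) s) s) s) s.
  by vm_compute.
have s8 (l : 'I_8) : val l \in s by rewrite mem_iota ltn_ord.
move=> /allP/(_ _ (s8 i))/allP/(_ _ (s8 j)).
by move=> /allP/(_ _ (s8 i'))/allP/(_ _ (s8 j'))/eqP.
Qed.

(* Add the expansion of the squared norm to its copy with the two occurrences of
   [x] exchanged, and apply [oct_gram_sym] termwise. *)
Lemma onormM {R : realType} (x y : octonion R) :
  onorm (omul x y) = onorm x * onorm y.
Proof.
rewrite /onorm -sqrtrM; last by apply: sumr_ge0 => i _; exact: sqr_ge0.
congr Num.sqrt.
pose X i j i' j' := x 0 i * y 0 j * (x 0 i' * y 0 j').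
pose G i j i' j' : R := X i j i' j' * (oct_gram i j i' j')%:~R.
have -> : \sum_(k < 8) omul x y 0 k ^+ 2 =
    \sum_(i < 8) \sum_(j < 8) \sum_(i' < 8) \sum_(j' < 8) G i j i' j'.
  under eq_bigr => k _.
    rewrite expr2 omulE mulr_suml.
    under eq_bigr => i _.
      rewrite mulr_suml.
      under eq_bigr => j _.
        rewrite mulr_sumr.
        under eq_bigr do rewrite mulr_sumr.
        over.
      over.
    over.
  rewrite exchange_big; apply: eq_bigr => i _.
  rewrite exchange_big; apply: eq_bigr => j _.
  rewrite exchange_big; apply: eq_bigr => i' _.
  rewrite exchange_big; apply: eq_bigr => j' _.
  rewrite /G oct_gramE rmorph_sum mulr_sumr; apply: eq_bigr => k _.
  by rewrite rmorphM /= mulrACA.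
set S := LHS.
have S' :
    S = \sum_(i < 8) \sum_(j < 8) \sum_(i' < 8) \sum_(j' < 8) G i' j i j'.
  rewrite /S; under eq_bigr => i _ do rewrite exchange_big.
  rewrite exchange_big; apply: eq_bigr => i _.
  by rewrite exchange_big; apply: eq_bigr => j _.
have GE i j i' j' :
    G i j i' j' + G i' j i j' = X i j i' j' * 2 * ((i == i') && (j == j'))%:R.
  rewrite /G (_ : X i' j i j' = X i j i' j'); last first.
    by rewrite /X [LHS]mulrACA [RHS]mulrACA [x 0 i' * _]mulrC.
  by rewrite -mulrDr -rmorphD oct_gram_sym /= natrM rmorphM /= !rmorph_nat mulrA.
apply: (@mulIf _ 2%:R); first by rewrite pnatr_eq0.
rewrite mulr_natr mulr2n {2}S' /S -big_split /= mulr_suml mulr_suml.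
apply: eq_bigr => i _; rewrite mulr_sumr mulr_suml -big_split /=.
apply: eq_bigr => j _; rewrite -big_split /= (bigD1 i) //= -big_split /=.
rewrite (bigD1 j) //= GE !eqxx [Z in _ + Z + _]big1 => [|j' jj]; last first.
  by rewrite GE eqxx eq_sym (negbTE jj) mulr0.
rewrite big1 => [|i' ii]; first by rewrite mulr1 !addr0 /X -!expr2 exprMn.
rewrite -big_split /= big1 // => j' _.
by rewrite GE eq_sym (negbTE ii) mulr0.
Qed.

Definition nwords (n : nat) (nu : multiindex) : nat :=
  #|[pred w : n.-tuple 'I_7 | [forall s, count_mem s w == nu s]]|.

Lemma big_tupleS (T : finType) (n : nat) (F : n.+1.-tuple T -> nat) :
  (\sum_w F w = \sum_s \sum_(w : n.-tuple T) F (cons_tuple s w))%N.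
Proof.
rewrite (reindex (fun p : T * n.-tuple T => cons_tuple p.1 p.2)) /=.
  by rewrite pair_big.
exists (fun w => (thead w, behead_tuple w)) => [[s w] _|w _].
  by congr pair; apply: val_inj.
by rewrite [RHS]tuple_eta; apply: val_inj.
Qed.

Lemma nwords_fact (n : nat) (nu : multiindex) :
  mnorm nu = n -> (nwords n nu * \prod_(i < 7) (nu i)`! = n`!)%N.
Proof.
elim: n nu => [|n IH] nu nun.
  have nu0 i : nu i = 0%N.
    by apply/eqP; rewrite -leqn0 -[leqRHS]nun /mnorm (bigD1 i) //= leq_addr.
  rewrite big1 ?muln1 => [|i _]; last by rewrite nu0.
  rewrite -[RHS](card1 ([tuple] : 0.-tuple 'I_7)); apply: eq_card => w.
  rewrite tuple0 !inE [RHS]eqxx.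
  by apply/forallP => s; rewrite nu0.
rewrite /nwords -sum1_card big_mkcond big_tupleS big_distrl /= factS.
rewrite -[in RHS]nun /mnorm big_distrl /=; apply: eq_bigr => s _.
have [nus|nus] := posnP (nu s).
  rewrite nus mul0n big1 ?mul0n // => w _; rewrite inE.
  by case: ifP => // /forallP/(_ s); rewrite /= eqxx nus.
pose mu : multiindex := [ffun t => nu t - (t == s)]%N.
have nuE t : (nu t = (s == t) + mu t)%N.
  by rewrite ffunE eq_sym; case: eqP => [->|_]; rewrite ?subnKC // subn0.
have mun : mnorm mu = n.
  apply/eqP; rewrite -eqSS -nun /mnorm (bigD1 s) //= [eqbRHS](bigD1 s) //=.
  rewrite [nu s]nuE eqxx /= add1n addSn eqSS; apply/eqP; congr addn.
  by apply: eq_bigr => t ts; rewrite nuE eq_sym (negbTE ts).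
have -> : (\prod_(i < 7) (nu i)`! = nu s * \prod_(i < 7) (mu i)`!)%N.
  rewrite (bigD1 s) //= [in RHS](bigD1 s) //= mulnA.
  congr muln; first by rewrite {1 2}nuE eqxx add1n factS.
  by apply: eq_bigr => t ts; rewrite nuE eq_sym (negbTE ts).
rewrite mulnCA -(IH _ mun) /nwords -sum1_card [in RHS]big_mkcond.
congr (_ * (_ * _))%N.
apply: eq_bigr => w _; rewrite !inE; congr (if _ then _ else _).
by apply: eq_forallb => t; rewrite /= [nu t]nuE eqn_add2l.
Qed.

Lemma multinomialE {R : realType} (nu : multiindex) :
  multinomial nu = (nwords (mnorm nu) nu)%:R :> R.
Proof.
rewrite /multinomial -(nwords_fact _ _ erefl) natrM natr_prod mulfK //.
by apply/prodf_neq0 => i _; rewrite pnatr_eq0 -lt0n fact_gt0.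
Qed.

Lemma multinomial_ge1 {R : realType} (nu : multiindex) :
  1 <= multinomial nu :> R.
Proof.
rewrite multinomialE ler1n lt0n; apply: contra_eqN (nwords_fact _ nu erefl).
by move=> /eqP nw0; rewrite nw0 mul0n eq_sym -lt0n fact_gt0.
Qed.

Lemma sum_multinomial_le {R : realType} (n : nat) :
  \sum_(nu <- midx n) multinomial nu <= 7 ^+ n :> R.
Proof.
rewrite -natrX.
have -> : (\sum_(nu <- midx n) multinomial nu : R) =
    (\sum_(nu <- midx n) nwords n nu)%N%:R.
  rewrite natr_sum !big_seq; apply: eq_bigr => nu.
  by rewrite mem_midx multinomialE => /eqP ->.
rewrite ler_nat /nwords.
under eq_bigr do rewrite -sum1_card big_mkcond.
rewrite exchange_big /= -[X in (X ^ n)%N](card_ord 7) -card_tuple -sum1_card.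
apply: leq_sum => w _; rewrite -big_mkcond sum1_count.
rewrite (@eq_count _ _ (pred1 [ffun s => count_mem s w])) => [|nu].
  by rewrite count_uniq_mem ?midx_uniq // leq_b1.
rewrite /= inE; apply/forallP/eqP => [nuw|-> s]; last by rewrite ffunE.
by apply/ffunP => s; rewrite ffunE (eqP (nuw s)).
Qed.

Lemma limn_esup_ge0 {R : realType} (u : (\bar R) ^nat) :
  (forall n, (0 <= u n)%E) -> (0 <= limn_esup u)%E.
Proof.
move=> u0; apply: le_ereal_inf_tmp => _ [V [N _ NV] <-].
apply: (le_trans (u0 N)); apply: ereal_sup_ubound.
by exists N => //; apply: NV => /=.
Qed.

Lemma limn_esup_le {R : realType} (u : (\bar R) ^nat) (b : \bar R) :
  (\forall n \near \oo, (u n <= b)%E) -> (limn_esup u <= b)%E.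
Proof.
move=> [N _ Nb]; apply: (@le_trans _ _ (ereal_sup (u @` [set n | (N <= n)%N]))).
  by apply: ereal_inf_lbound; exists [set n | (N <= n)%N] => //; exists N.
by apply: ge_ereal_sup => _ [n Nn <-]; exact: Nb.
Qed.

Lemma limn_esup_lt {R : realType} (u : (\bar R) ^nat) (b : \bar R) :
  (limn_esup u < b)%E -> \forall n \near \oo, (u n < b)%E.
Proof.
move=> /ereal_inf_lt[_ [V nV <-] Vb]; apply: filterS nV => n Vn.
by apply: le_lt_trans Vb; apply: ereal_sup_ubound; exists n.
Qed.

Lemma root_expr {R : realType} (a : R) (n : nat) :
  0 <= a -> (0 < n)%N -> (a `^ n%:R^-1) ^+ n = a.
Proof.
move=> a0 n0; rewrite -powR_mulrn ?powR_ge0 // -powRrM mulVf ?powRr1 //.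
by rewrite pnatr_eq0 -lt0n.
Qed.

Lemma root_test {R : realType} (u : R ^nat) (a : R) :
  (forall n, 0 <= u n) ->
  (limn_esup (fun n => (u n `^ n%:R^-1)%:E) < a%:E)%E ->
  \forall n \near \oo, u n <= a ^+ n.
Proof.
move=> u0 /limn_esup_lt ua; near=> n.
have n0 : (0 < n)%N by near: n; exact: nbhs_infty_gt.
rewrite -(root_expr _ _ (u0 n) n0); apply: lerXn2r; rewrite ?nnegrE ?powR_ge0 //.
  apply: (@le_trans _ _ (u n `^ n%:R^-1)); rewrite ?powR_ge0 //.
  by rewrite -lee_fin ltW //; near: n.
by rewrite -lee_fin ltW //; near: n.
Unshelve. all: by end_near. Qed.

HB.instance Definition _ (R : realType) (m n : nat) :=
  Complete.on 'M[R]_(m.+1, n.+1).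

Lemma weierstrass_M_test {R : realType} {T : choiceType}
    {V : completeNormedModType R} (f : nat -> T -> V) (g : R ^nat) (K : set T) :
  cvgn (series g) ->
  (\forall n \near \oo, forall x, K x -> `|f n x| <= g n) ->
  {uniform K, (fun N x => series (f ^~ x) N) @ \oo -->
    fun x => limn (series (f ^~ x))}.
Proof.
move=> /cauchy_cvgP/cauchy_seriesP cg [N1 _ fg].
have tail e : 0 < e -> \forall n \near (\oo, \oo),
    forall x, K x -> `|\sum_(n.1 <= k < n.2) f k x| < e.
  move=> e0; have [[A B] [[N2 _ A2] [N3 _ B3]] AB] := cg e e0.
  exists ([set n | N1 <= n]%N `&` A, B).
    split; last by exists N3.
    by apply: filterI; [exact: nbhs_infty_ge|exists N2].
  move=> [m n] [[/= N1m Am] Bn] x Kx.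
  apply: le_lt_trans (AB (m, n) (conj Am Bn)) => /=.
  apply: (le_trans (ler_norm_sum _ _ _)); apply: le_trans (ler_norm _).
  apply: ler_sum_nat => k /andP[mk _].
  by apply: fg => //=; exact: leq_trans mk.
have cf x : K x -> cvgn (series (f ^~ x)).
  move=> Kx; apply/cauchy_cvgP/cauchy_seriesP => e /tail.
  by apply: filterS => n; exact.
move=> P /uniform_nbhs [E [entE EP]].
have [e /= e0 eE] :
    exists2 e : R, 0 < e & forall y z : V, `|y - z| < e -> E (y, z).
  move: entE; rewrite -entourage_ballE => -[e e0 eE]; exists e => // y z yz.
  by apply: eE => /=; rewrite -ball_normE.
have e20 : 0 < e / 2 by rewrite divr_gt0.
have [[A B] [/= nA nB] AB] := tail _ e20.
near=> n; apply: EP => x Kx; apply: eE.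
have /cvgrPdist_lt/(_ _ e20) : series (f ^~ x) @ \oo --> limn (series (f ^~ x)).
  exact: cf.
move=> lim_near.
near \oo => m.
rewrite [e]splitr; apply: (le_lt_trans (ler_distD (series (f ^~ x) m) _ _)).
apply: ltrD; first by near: m; exact: lim_near.
rewrite sub_series.
have nm : (n <= m)%N by near: m; exact: nbhs_infty_ge.
rewrite nm; apply: (AB (n, m)) => //; split => /=; first by near: n.
by near: m.
Unshelve. all: by end_near. Qed.

Lemma onorm_ge0 {R : realType} (x : octonion R) : 0 <= onorm x.
Proof. exact: sqrtr_ge0. Qed.

Lemma onormZ {R : realType} (a : R) (x : octonion R) :
  onorm (a *: x) = `|a| * onorm x.
Proof.
rewrite /onorm -sqrtr_sqr -sqrtrM ?sqr_ge0 // mulr_sumr; congr Num.sqrt.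
by apply: eq_bigr => i _; rewrite mxE exprMn.
Qed.

Lemma onorm1 {R : realType} : onorm (oe ord0 : octonion R) = 1.
Proof.
rewrite /onorm (bigD1 ord0) //= big1 => [|i i0].
  by rewrite mxE !eqxx expr1n addr0 sqrtr1.
by rewrite mxE (negbTE i0) andbF expr0n.
Qed.

Lemma onorm_zeta {R : realType} (i : 'I_7) (x : octonion R) :
  onorm (zeta i x) = Num.sqrt (x 0 (im7 i) ^+ 2 + x 0 ord0 ^+ 2).
Proof.
have im0 : (im7 i == ord0) = false by rewrite eq_sym; apply/negbTE/neq_lift.
rewrite /onorm (bigD1 ord0) //= (bigD1 (im7 i)) ?im0 //=.
rewrite big1 => [|j /andP[j0 ji]].
  rewrite !mxE !eqxx im0 [ord0 == _]eq_sym im0 /= !mulr1 !mulr0 subr0 sub0r addr0.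
  by rewrite sqrrN.
by rewrite !mxE (negbTE j0) (negbTE ji) !mulr0 subr0 expr0n.
Qed.

Lemma onorm_zeta_le {R : realType} (i : 'I_7) (x : octonion R) :
  onorm (zeta i x) <= onorm' x.
Proof. exact: (le_bigmax _ (fun i => onorm (zeta i x))). Qed.

Lemma onorm'_ge0 {R : realType} (x : octonion R) : 0 <= onorm' x.
Proof. exact: le_trans (onorm_ge0 _) (onorm_zeta_le ord0 x). Qed.

Lemma onorm_foldl_le {R : realType} (w : seq 'I_7) (x y : octonion R) :
  onorm (foldl (fun y i => omul y (zeta i x)) y w) <=
  onorm y * onorm' x ^+ size w.
Proof.
elim: w y => [|i w IH] y /=; first by rewrite mulr1.
apply: (le_trans (IH _)); rewrite onormM exprS mulrA.
apply: ler_wpM2r; first by rewrite exprn_ge0 ?onorm'_ge0.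
by apply: ler_wpM2l; [exact: onorm_ge0|exact: onorm_zeta_le].
Qed.

(* The factor 8 comes from applying the triangle inequality to the sup norm. *)
Lemma onorm_oV_le {R : realType} (nu : multiindex) (x : octonion R) :
  onorm (oV nu x) <=
  8 * ((mnorm nu)`!%:R^-1 * (multinomial nu * onorm' x ^+ mnorm nu)).
Proof.
rewrite onormZ ger0_norm ?invr_ge0 ?ler0n // mulrCA.
apply: ler_wpM2l; first by rewrite invr_ge0 ler0n.
apply: (le_trans (onorm_equiv _).2); apply: ler_wpM2l => //.
apply: (le_trans (ler_norm_sum _ _ _)).
rewrite multinomialE mulr_natl /nwords -sumr_const; apply: ler_sum => w _.
apply: (le_trans (onorm_equiv _).1); apply: (le_trans (onorm_foldl_le _ _ _)).
by rewrite onorm1 mul1r size_tuple.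
Qed.

Definition coef_max {R : realType} (c : multiindex -> octonion R) (n : nat) : R :=
  \big[Num.max/0]_(nu <- midx n) onorm (n`!%:R^-1 *: c nu).

Definition supp_mult {R : realType} (c : multiindex -> octonion R) (n : nat) : R :=
  \sum_(nu <- midx n | c nu != 0) multinomial nu.

Definition layer {R : realType} (c : multiindex -> octonion R) (n : nat)
    (x : octonion R) : octonion R :=
  \sum_(nu <- midx n) omul (oV nu x) (c nu).

Lemma coef_max_ge0 {R : realType} (c : multiindex -> octonion R) (n : nat) :
  0 <= coef_max c n.
Proof. exact: bigmax_ge_id. Qed.

Lemma multinomial_ge0 {R : realType} (nu : multiindex) :
  0 <= multinomial nu :> R.
Proof. exact: le_trans (multinomial_ge1 nu). Qed.

Lemma supp_mult_ge0 {R : realType} (c : multiindex -> octonion R) (n : nat) :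
  0 <= supp_mult c n.
Proof. by apply: sumr_ge0 => nu _; exact: multinomial_ge0. Qed.

Lemma supp_mult_le {R : realType} (c : multiindex -> octonion R) (n : nat) :
  supp_mult c n <= 7 ^+ n.
Proof.
apply: le_trans (sum_multinomial_le n); rewrite /supp_mult big_mkcond /=.
by apply: ler_sum => nu _; case: ifP => // _; exact: multinomial_ge0.
Qed.

Lemma layer_le {R : realType} (c : multiindex -> octonion R) (n : nat)
    (x : octonion R) :
  `|layer c n x| <= 8 * (supp_mult c n * coef_max c n * onorm' x ^+ n).
Proof.
apply: (le_trans (ler_norm_sum _ _ _)).
rewrite /supp_mult !mulr_suml mulr_sumr [leRHS]big_mkcond /=.
rewrite big_seq [leRHS]big_seq.
apply: ler_sum => nu nun; apply: (le_trans (onorm_equiv _).1).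
have nunE : mnorm nu = n by apply/eqP; rewrite -mem_midx.
rewrite onormM; case: eqP => [-> | _] /=.
  by rewrite -(scale0r 0) onormZ normr0 mul0r mulr0.
apply: le_trans (ler_wpM2r (onorm_ge0 _) (onorm_oV_le _ _)) _; rewrite nunE.
rewrite -[leLHS]mulrA; apply: ler_wpM2l => //.
have -> : n`!%:R^-1 * (multinomial nu * onorm' x ^+ n) * onorm (c nu) =
    multinomial nu * onorm (n`!%:R^-1 *: c nu) * onorm' x ^+ n :> R.
  rewrite onormZ ger0_norm ?invr_ge0 ?ler0n //; move: (multinomial nu) => m.
  rewrite -!mulrA [LHS]mulrCA.
  by rewrite [onorm (c nu) * _]mulrC.
apply: ler_wpM2r; first by rewrite exprn_ge0 ?onorm'_ge0.
apply: ler_wpM2l; first exact: multinomial_ge0.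
pose F mu := onorm (n`!%:R^-1 *: c mu).
exact: (le_bigmax_seq _ _ xpredT F nun isT).
Qed.

Lemma coef_max_eq0 {R : realType} (c : multiindex -> octonion R) (n : nat) :
  supp_mult c n < 1 -> coef_max c n = 0.
Proof.
move=> c1; apply/eqP; rewrite eq_le coef_max_ge0 andbT /coef_max big_seq.
apply: bigmax_le => // nu nun.
suff -> : c nu = 0 by rewrite onormZ -(scale0r 0) onormZ normr0 mul0r mulr0.
apply/eqP; apply: contraTT c1 => cnu; rewrite -leNgt.
apply: (le_trans (multinomial_ge1 nu)).
rewrite /supp_mult big_mkcond (bigD1_seq nu) ?midx_uniq //= cnu lerDl.
by apply: sumr_ge0 => mu _; case: ifP => // _; exact: multinomial_ge0.
Qed.

Lemma tau_ge0 {R : realType} (c : multiindex -> octonion R) : (0 <= tau c)%E.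
Proof. by apply: limn_esup_ge0 => n; rewrite lee_fin powR_ge0. Qed.

Lemma rho_ge0 {R : realType} (c : multiindex -> octonion R) : (0 <= rho c)%E.
Proof. by apply: limn_esup_ge0 => n; rewrite lee_fin powR_ge0. Qed.

Lemma tau_le7 {R : realType} (c : multiindex -> octonion R) : (tau c <= 7%:E)%E.
Proof.
apply: limn_esup_le; near=> n.
have n0 : (0 < n)%N by near: n; exact: nbhs_infty_gt.
rewrite lee_fin -(ler_pXn2r n0) ?nnegrE ?powR_ge0 //.
by rewrite root_expr ?supp_mult_le // supp_mult_ge0.
Unshelve. all: by end_near. Qed.

(* Nonzero [supp_mult c n] are at least 1, so [tau c < 1] forces the support of
   [c] to be finite. *)
Lemma rho_eq0 {R : realType} (c : multiindex -> octonion R) :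
  tau c = 0%E -> rho c = 0%E.
Proof.
move=> tau0; apply/eqP; rewrite eq_le rho_ge0 andbT.
have : (tau c < (2^-1)%:E)%E by rewrite tau0 lte_fin invr_gt0.
move/(root_test _ _ (supp_mult_ge0 c)) => supp.
apply: limn_esup_le; near=> n.
have n0 : (0 < n)%N by near: n; exact: nbhs_infty_gt.
rewrite -/(coef_max c n) coef_max_eq0 ?powR0 ?invr_eq0 ?pnatr_eq0 -?lt0n //.
apply: (@le_lt_trans _ _ (2^-1 ^+ n)); first by near: n; exact: supp.
by rewrite exprn_ilt1 ?invf_lt1 ?ltr1n // -lt0n.
Unshelve. all: by end_near. Qed.

Lemma radius_fin {R : realType} (c : multiindex -> octonion R) (s : R) :
  0 <= s -> (s%:E < (tau c * rho c)^-1)%E ->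
  exists t r : R, [/\ tau c = t%:E, rho c = r%:E & t * r * s < 1].
Proof.
move=> s0; have := rho_eq0 c.
have := tau_ge0 c; have := tau_le7 c; case: (tau c) => // t _ t0.
have := rho_ge0 c; case: (rho c) => [r r0 _|_ rho0|] //; last first.
  have [t_eq0|tN0] := eqVneq t 0; first by have := rho0 (congr1 _ t_eq0).
  have t_gt0 : (0 < t%:E)%E by rewrite lt_def eqe tN0.
  by rewrite gt0_muley // invey lte_fin ltNge s0.
rewrite -EFinM inver; case: eqP => [tr0 _|/eqP trN0 str]; exists t, r; split=> //.
  by rewrite tr0 mul0r.
have tr0 : 0 < t * r by rewrite lt_def trN0 mulr_ge0.
by rewrite mulrC -ltr_pdivlMr // mul1r.
Qed.

Lemma radius_root {R : realType} (c : multiindex -> octonion R) (s : R) :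
  0 <= s -> (s%:E < (tau c * rho c)^-1)%E ->
  exists2 q : R, 0 <= q < 1 &
    \forall n \near \oo, supp_mult c n * coef_max c n * s ^+ n <= q ^+ n.
Proof.
move=> s0 /(radius_fin _ _ s0) [t [r [taut rhor trs]]].
have t0 : 0 <= t by rewrite -lee_fin -taut tau_ge0.
have r0 : 0 <= r by rewrite -lee_fin -rhor rho_ge0.
pose D := 1 + s * (t + r + 1).
have D0 : 0 < D by rewrite ltr_pwDl // mulr_ge0 // !addr_ge0.
have [e [e0 e1 eD]] : exists e, [/\ 0 < e, e <= 1 & e * D = 1 - t * r * s].
  exists ((1 - t * r * s) / D); rewrite divr_gt0 ?subr_gt0 // divfK ?gt_eqF //.
  split=> //; rewrite ler_pdivrMr // mul1r lerD // (@le_trans _ _ 0) //.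
    by rewrite oppr_le0 !mulr_ge0.
  by rewrite mulr_ge0 // !addr_ge0.
exists ((t + e) * (r + e) * s).
  rewrite !mulr_ge0 ?addr_ge0 ?(ltW e0) //=.
  have : 0 <= (1 - e) * e * s by rewrite !mulr_ge0 ?subr_ge0 ?(ltW e0).
  by move: eD; rewrite /D; lra.
have tauN : (tau c < (t + e)%:E)%E by rewrite taut lte_fin ltrDl.
have rhoN : (rho c < (r + e)%:E)%E by rewrite rhor lte_fin ltrDl.
have supp := root_test _ _ (supp_mult_ge0 c) tauN.
have coef := root_test _ _ (coef_max_ge0 c) rhoN.
near=> n; rewrite !exprMn; apply: ler_wpM2r; first by rewrite exprn_ge0.
apply: ler_pM; rewrite ?supp_mult_ge0 ?coef_max_ge0 //.
  by near: n; exact: supp.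
by near: n; exact: coef.
Unshelve. all: by end_near. Qed.

Lemma continuous_onorm' {R : realType} :
  continuous (onorm' : octonion R -> R).
Proof.
have -> : onorm' = fun x : octonion R => \big[Num.max/0]_(i < 7)
    Num.sqrt (x 0 (im7 i) ^+ 2 + x 0 ord0 ^+ 2).
  by apply/funext => x; apply: eq_bigr => i _; rewrite onorm_zeta.
apply: continuous_big => [|i _]; first exact: max_continuous.
move=> x; apply: continuous_comp; last exact: sqrt_continuous.
have coord (j : 'I_8) : {for x, continuous (fun x : octonion R => x 0 j ^+ 2)}.
  apply: (@continuous_comp _ _ _ (fun x : octonion R => x 0 j) (fun y => y ^+ 2)).
    exact: coord_continuous.
  exact: exprn_continuous.
exact: (@continuousD _ _ _ _ _ _ (coord (im7 i)) (coord ord0)).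
Qed.

(* World: MathComp-Analysis. The inverse is that of \bar R: 0^-1 = +oo and
   +oo^-1 = 0; the product 0 * +oo does not occur, since rho c = +oo forces
   1 <= tau c. *)
Theorem theorem5p0p5 (R : realType) (c : multiindex -> octonion R) :
  compactly_convergent
    [set x : octonion R | ((onorm' x)%:E < (tau c * rho c)^-1)%E]
    (psum c).
Proof.
exists (fun x => limn (series (fun n => layer c n x))) => K cK KU.
have psumE : psum c = fun N x => series (layer c ^~ x) N.+1.
  by apply/funext => N; apply/funext => x; rewrite /series /= big_mkord.
rewrite psumE.
suff [g cg lg] : exists2 g : R ^nat, cvgn (series g) &
    \forall n \near \oo, forall x, K x -> `|layer c n x| <= g n.
  apply: (@cvg_comp _ _ _ succn (fun N x => series (layer c ^~ x) N) \oo \oo).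
    by move=> P [N _ NP]; exists N => // n /leqW /NP.
  exact: weierstrass_M_test cg lg.
have [K0|KN0] := eqVneq K set0.
  exists (geometric 0 0); first by apply: is_cvg_geometric_series; rewrite normr0.
  by near=> n => x; rewrite K0.
have [a aK amax] :=
  compact_EVT_max ((set0P _).1 KN0) cK
  (continuous_subspaceT continuous_onorm').
have [q /andP[q0 q1] qle] := radius_root c _ (onorm'_ge0 a) (KU _ (set_mem aK)).
exists (geometric 8 q).
  by apply: is_cvg_geometric_series; rewrite ger0_norm.
near=> n => x Kx; apply: (le_trans (layer_le _ _ _)).
rewrite /geometric /=; apply: ler_wpM2l => //.
apply: (@le_trans _ _ (supp_mult c n * coef_max c n * onorm' a ^+ n)).
  apply: ler_wpM2l; first by rewrite mulr_ge0 ?supp_mult_ge0 ?coef_max_ge0.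
  by apply: lerXn2r; rewrite ?nnegrE ?onorm'_ge0 // amax // inE.
by near: n; exact: qle.
Unshelve. all: by end_near. Qed.
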